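(* If $\mathcal{I}$ is a P-ideal on $\omega$, then $$\mathfrak{b}\le\mathfrak{b}(\mathcal{I},\mathrm{Fin},\mathrm{Fin})=\mathfrak{b}(\mathcal{I},\mathcal{I},\mathcal{I})=\mathfrak{b}(\mathcal{I},\mathrm{Fin},\mathcal{I})=\mathfrak{b}(\mathcal{I},\mathcal{I},\mathrm{Fin})\le\mathfrak{d}.$$
   Context: An ideal on $\omega$ is a family $\mathcal{I}\subseteq\mathcal{P}(\omega)$ closed under finite unions and subsets, containing all finite sets, with $\omega\notin\mathcal{I}$; $\mathrm{Fin}$ is the ideal of finite sets. $\mathcal{I}$ is a P-ideal if for every countable $\mathcal{A}\subseteq\mathcal{I}$ there is $B$ with $\omega\setminus B\in\mathcal{I}$ and $A\cap B$ finite for all $A\in\mathcal{A}$. $\mathfrak{b}$ and $\mathfrak{d}$ are the bounding and dominating numbers. For an ideal $\mathcal{K}$, $\widehat{\mathcal{P}}_{\mathcal{K}}$ is the family of sequences $\langle A_n\rangle$ of pairwise disjoint members of $\mathcal{K}$, and $\mathcal{P}_{\mathcal{K}}$ those with union $\omega$. $\mathfrak{b}(\mathcal{I},\mathcal{J},\mathcal{K})=\min\{|\mathcal{E}|:\mathcal{E}\subseteq\widehat{\mathcal{P}}_{\mathcal{K}},\ \forall\langle A_n\rangle\in\mathcal{P}_{\mathcal{J}}\ \exists\langle E_n\rangle\in\mathcal{E}\ \bigcup_n(A_n\cap\bigcup_{i\le n}E_i)\notin\mathcal{I}\}$, with $\min\emptyset=\mathfrak{c}^+$. *)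

(* Defs.v *)
From mathcomp Require Import all_boot.
From mathcomp Require Import boolp classical_sets functions cardinality.

Set Implicit Arguments.
Unset Strict Implicit.
Unset Printing Implicit Defensive.

Local Open Scope classical_set_scope.
Local Open Scope card_scope.
Local Open Scope quotient_scope.

(* Cardinal numbers, as equinumerosity classes of subsets of P(P(omega)). This
   type has one element for every cardinal up to 2^c. All families below are
   sets of functions in omega^omega or P(omega)^omega, hence of cardinality at
   most c, and c^+ <= 2^c, so every cardinal involved is represented. *)
Definition card_equiv (X Y : set (set (set nat))) : bool := X #= Y.

Lemma card_equiv_refl : reflexive card_equiv.
Proof. by move=> X; apply: card_eqxx. Qed.

Lemma card_equiv_sym : symmetric card_equiv.
Proof. by move=> X Y; apply: card_eq_sym. Qed.

Lemma card_equiv_trans : transitive card_equiv.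
Proof. by move=> Y X Z; apply: card_eq_trans. Qed.

Canonical card_equiv_rel :=
  EquivRel card_equiv card_equiv_refl card_equiv_sym card_equiv_trans.

Definition cardinal := {eq_quot card_equiv_rel}.

Definition has_card T (X : set T) (k : cardinal) : Prop := repr k #= X.

Definition cardinal_le (k l : cardinal) : Prop := repr k #<= repr l.

Declare Scope cardinal_scope.
Delimit Scope cardinal_scope with cardinal.
Notation "k <= l" := (cardinal_le k l) : cardinal_scope.

Definition is_least (S : set cardinal) (k : cardinal) : Prop :=
  S k /\ forall l, S l -> (k <= l)%cardinal.

(* By [ex_least] below, the default value [d] is returned exactly when S is
   empty. *)
Definition cardinal_min (d : cardinal) (S : set cardinal) : cardinal :=
  xget d [set k | is_least S k].

Lemma has_card_unique T (X : set T) (k l : cardinal) :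
  has_card X k -> has_card X l -> k = l.
Proof.
rewrite /has_card => Xk; rewrite card_eq_sym => Xl.
rewrite -[k]reprK -[l]reprK; apply/eqmodP; exact: card_eq_trans Xk Xl.
Qed.

Lemma ex_has_card T (X : set T) (f : T -> set (set nat)) :
  injective f -> exists k, has_card X k.
Proof.
move=> injf; exists (\pi_cardinal (f @` X)); rewrite /has_card.
have E : card_equiv (repr (\pi_cardinal (f @` X))) (f @` X).
  by apply/(@eqmodP _ card_equiv_rel); rewrite reprK.
by apply: card_eq_trans E _; apply: inj_card_eq => x y _ _ /injf.
Qed.

Lemma ex_least (S : set cardinal) : S !=set0 -> exists k, is_least S k.
Proof.
move=> [k0 Sk0]; apply: contrapT => noleast.
pose P (Z : set (cardinal -> set (set nat))) :=
  (forall z k, Z z -> S k -> repr k (z k)) /\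
  (forall y z k, Z y -> Z z -> S k -> y k = z k -> y = z).
have [|Z [[Zin Zinj] Zmax]] := @Zorn_bigcup _ P.
  move=> F FP totF; split.
    by move=> z k [A FA Az] Sk; have [+ _] := FP _ FA; apply.
  move=> y z k [A FA Ay] [B FB Bz] Sk.
  by case: (totF _ _ FA FB) => AB; [have [_ +] := FP _ FB|have [_ +] := FP _ FA];
    apply => //; apply: AB.
have [k Sk surjk] : exists2 k, S k & repr k `<=` (fun z => z k) @` Z.
  apply: contrapT => nosurj.
  have new k : exists x, S k -> repr k x /\ ~ ((fun z => z k) @` Z) x.
    have [Sk|nSk] := pselect (S k); last by exists set0.
    apply: contrapT => nox; apply: nosurj; exists k => // x kx.
    by apply: contrapT => nZx; apply: nox; exists x.
  have [w Hw] := choice new.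
  have nZw : ~ Z w by move=> Zw; have [_] := Hw _ Sk0; apply; exists w.
  apply: (Zmax (Z `|` [set w])).
    split; first by left.
    by move=> sub; apply: nZw; apply: sub; right.
  split.
    by move=> z k [Zz|->] Sk; [exact: Zin|have [] := Hw _ Sk].
  move=> y z k [Zy|->] [Zz|->] Sk // e; first exact: Zinj e.
    by have [_ []] := Hw _ Sk; exists y.
  by have [_ []] := Hw _ Sk; exists z.
apply: noleast; exists k; split => // l Sl.
apply: (@card_le_trans _ _ _ Z).
  apply: card_le_trans (card_image_le (fun z => z k) Z).
  exact: subset_card_le.
apply: (@card_le_trans _ _ _ ((fun z : cardinal -> _ => z l) @` Z)).
  suff: (fun z : cardinal -> _ => z l) @` Z #= Z.
    by rewrite card_eq_le => /andP[].
  by apply: inj_card_eq => y z; rewrite !inE => Zy Zz e; apply: Zinj e.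
by apply: subset_card_le => _ [z Zz <-]; apply: Zin.
Qed.

(* c^+; the default value is irrelevant, see [succ_continuumP]. *)
Definition succ_continuum : cardinal :=
  cardinal_min (\pi_cardinal set0)
    [set k : cardinal | ~ (repr k #<= [set: set nat])].

Lemma succ_continuumP :
  is_least [set k : cardinal | ~ (repr k #<= [set: set nat])] succ_continuum.
Proof.
apply: xgetPex; apply: ex_least.
have [k hk] := ex_has_card [set: set (set nat)] (@inj_id _).
exists k => /= kle.
have : [set: set (set nat)] #<= [set: set nat].
  by rewrite -(card_le_eql hk).
move=> /pcard_injP[f injTf].
pose D := [set x : set nat | exists2 X, f X = x & ~ X x].
have injf : injective f by move=> X Y; apply: injTf; rewrite inE.
have [DfD|nDfD] := pselect (D (f D)); last by apply: (nDfD); exists D.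
by case: (DfD) => X /injf ->; apply.
Qed.

Definition eventually_le (f g : nat -> nat) : Prop :=
  finite_set [set n | (g n < f n)%N].

Definition bounding_number : cardinal :=
  cardinal_min succ_continuum [set k | exists F : set (nat -> nat),
    (forall g, exists2 f, F f & ~ eventually_le f g) /\ has_card F k].

Definition dominating_number : cardinal :=
  cardinal_min succ_continuum [set k | exists D : set (nat -> nat),
    (forall f, exists2 g, D g & eventually_le f g) /\ has_card D k].

Definition is_ideal (I : set (set nat)) : Prop :=
  [/\ forall A B, I A -> I B -> I (A `|` B),
      forall A B, A `<=` B -> I B -> I A,
      forall A, finite_set A -> I A
    & ~ I [set: nat]].

Definition Fin : set (set nat) := [set A | finite_set A].

Definition is_P_ideal (I : set (set nat)) : Prop :=
  is_ideal I /\
  forall AA : set (set nat), countable AA -> AA `<=` I ->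
    exists2 B, I (~` B) & forall A, AA A -> finite_set (A `&` B).

Definition disjoint_seqs (K : set (set nat)) : set (nat -> set nat) :=
  [set E | (forall n, K (E n)) /\ trivIset [set: nat] E].

Definition partition_seqs (J : set (set nat)) : set (nat -> set nat) :=
  [set A | disjoint_seqs J A /\ \bigcup_n A n = [set: nat]].

Definition ideal_b (I J K : set (set nat)) : cardinal :=
  cardinal_min succ_continuum [set k | exists EE : set (nat -> set nat),
    [/\ EE `<=` disjoint_seqs K,
        forall A, partition_seqs J A -> exists2 E, EE E &
          ~ I (\bigcup_n (A n `&` \bigcup_(i < n.+1) E i))
      & has_card EE k]].

(* Main.v *)
Require Import Defs.
From mathcomp Require Import all_boot.
From mathcomp Require Import boolp classical_sets functions cardinality.

(** Shrinking the ideals J and K moves b(I,J,K) in opposite directions, so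
    b(I,Fin,I) is the smallest and b(I,I,Fin) the largest of the four values.
    They coincide because a P-ideal provides, for every sequence in I, a set B
    with complement in I on which every term is finite: cutting both the E_n and
    the A_n down to such sets changes the union of the A_n with the E_i, i <= n,
    only by a member of I.
    The comparison with b and d then only concerns sequences of finite sets,
    where the E_n are encoded by a function bounding E_0, ..., E_n, and a
    function g by a partition of omega whose n-th piece lies above g(n). *)

Set Implicit Arguments.
Unset Strict Implicit.
Unset Printing Implicit Defensive.

Local Open Scope classical_set_scope.
Local Open Scope card_scope.

(** * Cardinals *)

Lemma cardinal_le_trans (k l m : cardinal) :
  (k <= l)%cardinal -> (l <= m)%cardinal -> (k <= m)%cardinal.
Proof. exact: card_le_trans. Qed.

Lemma cardinal_le_anti (k l : cardinal) :
  (k <= l)%cardinal -> (l <= k)%cardinal -> k = l.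
Proof.
move=> kl lk; apply: (@has_card_unique _ (repr l)); last exact: card_eqxx.
by rewrite /has_card card_eq_le; apply/andP.
Qed.

(** Comparability follows from the existence of least elements, applied to the pair {k, l}. *)
Lemma cardinal_le_total (k l : cardinal) :
  (k <= l)%cardinal \/ (l <= k)%cardinal.
Proof.
have [|m [[->|->] least]] := @ex_least [set k; l]; first by exists k; left.
  by left; apply: least; right.
by right; apply: least; left.
Qed.

Lemma cardinal_le_succ_continuum (k : cardinal) :
  repr k #<= [set: set nat] -> (k <= succ_continuum)%cardinal.
Proof.
move=> kc; have [//|sk] := cardinal_le_total k succ_continuum.
by have [/= + _] := succ_continuumP; case; exact: card_le_trans sk kc.
Qed.

Lemma cardinal_minP (d : cardinal) (S : set cardinal) :
  S !=set0 -> is_least S (cardinal_min d S).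
Proof. by move=> /ex_least; apply: xgetPex. Qed.

Lemma cardinal_min_set0 (d : cardinal) (S : set cardinal) :
  ~ (S !=set0) -> cardinal_min d S = d.
Proof. by move=> S0; apply: xgetPN => k [Sk _]; apply: S0; exists k. Qed.

(** The bound on members of S settles the case of empty S', where the right side is the default
    c^+. *)
Lemma cardinal_min_le (S S' : set cardinal) :
  (forall k, S k -> repr k #<= [set: set nat]) ->
  (forall k, S' k -> exists2 l, S l & (l <= k)%cardinal) ->
  (cardinal_min succ_continuum S <= cardinal_min succ_continuum S')%cardinal.
Proof.
move=> Sc S'S; have [S'0|S'0] := pselect (S' !=set0).
  have [/S'S[l Sl lk] _] := cardinal_minP succ_continuum S'0.
  apply: cardinal_le_trans lk.
  by have [_] := cardinal_minP succ_continuum (ex_intro _ l Sl); apply.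
rewrite (cardinal_min_set0 _ S'0).
have [S0|S0] := pselect (S !=set0); last first.
  by rewrite (cardinal_min_set0 _ S0); exact: card_lexx.
apply: cardinal_le_succ_continuum; apply: Sc.
by have [] := cardinal_minP succ_continuum S0.
Qed.

Lemma has_card_le_continuum T (e : T -> set nat) (X : set T) (k : cardinal) :
  injective e -> has_card X k -> repr k #<= [set: set nat].
Proof.
move=> inje; rewrite /has_card => /card_le_eql ->.
apply: card_le_trans (subset_card_le (@subsetT _ (e @` X))).
suff: e @` X #= X by rewrite card_eq_le => /andP[].
by apply: inj_card_eq => x y _ _ /inje.
Qed.

Lemma has_card_image T U (e : U -> set nat) (phi : T -> U) (X : set T)
    (k : cardinal) : injective e -> has_card X k ->
  exists2 l, has_card (phi @` X) l & (l <= k)%cardinal.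
Proof.
move=> inje Xk.
have inj1 : injective (fun u => [set e u]).
  by move=> u v /= uv; apply: inje; have : [set e u] (e u) by []; rewrite uv.
have [l Xl] := ex_has_card (phi @` X) inj1; exists l => //.
rewrite /cardinal_le (card_le_eql Xl) (card_le_eqr Xk).
exact: card_image_le.
Qed.

(** Coding pairs embeds P(omega)^omega into P(omega), so a family of sequences has at most c
    members. *)
Definition set_of_seq (E : nat -> set nat) : set nat :=
  [set m | exists2 p : nat * nat, pickle p = m & E p.1 p.2].

Lemma set_of_seq_inj : injective set_of_seq.
Proof.
have sub E F : set_of_seq E = set_of_seq F -> forall n, E n `<=` F n.
  move=> EF n x Enx.
  have : set_of_seq E (pickle (n, x)) by exists (n, x).
  by rewrite EF => -[p /(pcan_inj pickleK) -> ].
by move=> E F EF; apply/funext => n; apply/seteqP; split; apply: sub.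
Qed.

Definition set_of_fun (f : nat -> nat) : set nat :=
  set_of_seq (fun n => [set f n]).

Lemma set_of_fun_inj : injective set_of_fun.
Proof.
move=> f g /set_of_seq_inj fg; apply/funext => n.
by have : [set f n] (f n) by []; rewrite (congr1 (@^~ n) fg).
Qed.

(** A family witnessing b(I,J',K') is pushed forward along [phi], which cannot increase its
    cardinality. *)
Lemma ideal_b_le (I J K J' K' : set (set nat))
    (phi : (nat -> set nat) -> nat -> set nat) :
  (forall EE, EE `<=` disjoint_seqs K' ->
     (forall A, partition_seqs J' A -> exists2 E, EE E &
        ~ I (\bigcup_n (A n `&` \bigcup_(i < n.+1) E i))) ->
     phi @` EE `<=` disjoint_seqs K /\
     forall A, partition_seqs J A -> exists2 E, EE E &
        ~ I (\bigcup_n (A n `&` \bigcup_(i < n.+1) phi E i))) ->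
  (ideal_b I J K <= ideal_b I J' K')%cardinal.
Proof.
move=> H; apply: cardinal_min_le => k [EE [EEK EEu EEk]].
  exact: has_card_le_continuum set_of_seq_inj EEk.
have [l hl lk] := has_card_image phi set_of_seq_inj EEk.
exists l => //; exists (phi @` EE); have [? uphi] := H _ EEK EEu; split=> // A.
by move=> /uphi[E EEE nI]; exists (phi E) => //; exists E.
Qed.

(** A larger J means more partitions to defeat; a larger K admits more families. *)
Lemma ideal_b_mono (I J K J' K' : set (set nat)) :
  J `<=` J' -> K' `<=` K ->
  (ideal_b I J K <= ideal_b I J' K')%cardinal.
Proof.
move=> JJ' K'K; apply: (@ideal_b_le _ _ _ _ _ id) => EE EEK EEu; split.
  by rewrite image_id => E /EEK[KE tE]; split=> // n; apply: K'K.
by move=> A [[JA tA] cA]; apply: EEu; split=> //; split=> // n; apply: JJ'.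
Qed.

(** * Reduction to sequences of finite sets *)

Lemma P_ideal_trace (I : set (set nat)) (E : nat -> set nat) :
  is_P_ideal I -> (forall n, I (E n)) ->
  exists2 B, I (~` B) & forall n, finite_set (E n `&` B).
Proof.
move=> [_ PII] IE.
have [||B IB HB] := PII (range E).
- exact: card_image_le.
- by move=> _ [n _ <-].
- by exists B => // n; apply: HB; exists n.
Qed.

Lemma ideal_b_P_ideal (I : set (set nat)) : is_P_ideal I ->
  (ideal_b I I Fin <= ideal_b I Fin I)%cardinal.
Proof.
move=> PI; case: (PI) => -[IU Isub _ _] _.
(* The set [tr E] is chosen from E alone, before any partition is given, so that cutting down is a
   map on sequences. *)
have [tr trP] : {tr : (nat -> set nat) -> set nat & forall E,
    (forall n, I (E n)) -> I (~` tr E) /\ forall n, finite_set (E n `&` tr E)}.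
  apply: (@choice _ _ (fun E B => (forall n, I (E n)) ->
    I (~` B) /\ forall n, finite_set (E n `&` B))) => E.
  have [/(P_ideal_trace PI)[B]|nIE] := pselect (forall n, I (E n)).
    by exists B.
  by exists set0.
apply: (@ideal_b_le _ _ _ _ _ (fun E n => E n `&` tr E)) => EE EEI EEu; split.
  move=> _ [E /EEI[IE tE] <-]; split=> [n|].
    by have [_] := trP _ IE; apply.
  by move=> i j _ _ [x [[Eix _] [Ejx _]]]; apply: tE => //; exists x.
move=> A [[IA tA] cA].
have [B IB finB] := P_ideal_trace PI IA.
(* Adding {n} to the n-th trace when n is outside B restores a cover. *)
have [|E EEE nI] := EEu (fun n => (A n `&` B) `|` ([set n] `\` B)).
  split; first split=> [n|].
  - by rewrite /Fin /= finite_setU; split; [exact: finB|exact: finite_setD].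
  - move=> i j _ _ [x [[[Aix Bx]|[/= -> nB]] [[Ajx Bx']|[/= xj nB']]]] //.
    by apply: tA => //; exists x.
  apply/seteqP; split=> // x _.
  have [Bx|nBx] := pselect (B x); last by exists x => //; right.
  have : (\bigcup_n A n) x by rewrite cA.
  by case=> n _ Anx; exists n => //; left.
exists E => // IE'; apply: nI.
have [IE _] := EEI _ EEE.
(* A point lying in both B and [tr E] is in an original A n and a trimmed E i, so it is covered by
   [IE']. *)
apply: (Isub _ _ _ (IU _ _ IE' (IU _ _ IB (proj1 (trP _ IE))))).
move=> x [n _ [[[Anx Bx]|[_ nBx]] [i ilt Eix]]]; last by right; left.
have [trx|] := pselect (tr E x); last by right; right.
by left; exists n => //; split=> //; exists i.
Qed.

(** The squeeze is b(I,Fin,I) <= b(I,J,K) <= b(I,I,Fin) <= b(I,Fin,I). *)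
Lemma ideal_b_P_ideal_eq (I J K : set (set nat)) : is_P_ideal I ->
  Fin `<=` J -> J `<=` I -> Fin `<=` K -> K `<=` I ->
  ideal_b I J K = ideal_b I Fin I.
Proof.
move=> PI FJ JI FK KI; apply: cardinal_le_anti; last exact: ideal_b_mono.
by apply: cardinal_le_trans (ideal_b_P_ideal PI); exact: ideal_b_mono.
Qed.

(** * Comparison with the bounding and dominating numbers *)

Lemma finite_set_ubound (A : set nat) :
  finite_set A -> exists m, forall x, A x -> (x < m)%N.
Proof.
move=> /finite_seqP[s ->]; exists (\max_(x <- s) x).+1 => x /= xs.
by rewrite ltnS; exact: (leq_bigmax_seq (F := id) x xs).
Qed.

Lemma finite_seq_bound (E : nat -> set nat) : (forall n, finite_set (E n)) ->
  {f : nat -> nat & forall n x, E n x -> (x < f n)%N}.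
Proof. by move=> finE; exact: choice (fun n => finite_set_ubound (finE n)). Qed.

(* The piece n lies in [g n, g (n+1) + n + 1), except that the piece 0 starts
   at 0. *)
Lemma partition_above (g : nat -> nat) : exists2 A, partition_seqs Fin A &
  forall n x, A n x -> (0 < n)%N -> (g n <= x)%N.
Proof.
(* The summand n + 1 provides such an n even if g is bounded; the least one, when positive, has g n
   <= x by minimality. *)
have ex x : exists n, (x < g n.+1 + n.+1)%N.
  by exists x; exact: leq_addl.
have [h hP] : {h : nat -> nat & forall x,
    (x < g (h x).+1 + (h x).+1)%N /\ ((0 < h x)%N -> (g (h x) <= x)%N)}.
  apply: (@choice _ _ (fun x n =>
    (x < g n.+1 + n.+1)%N /\ ((0 < n)%N -> (g n <= x)%N))) => x.
  case: (ex_minnP (ex x)) => n xn minn; exists n; split=> //.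
  case: n xn minn => // n _ minn _; rewrite leqNgt; apply/negP => xg.
  have /minn : (x < g n.+1 + n.+1)%N by apply: leq_trans xg (leq_addr _ _).
  by rewrite ltnn.
exists (fun n => [set x | h x = n]); last by move=> _ x /= <-; apply: (hP x).2.
split; first split=> [n|]; last by apply/seteqP; split=> // x _; exists (h x).
  apply: (sub_finite_set _ (finite_II (g n.+1 + n.+1))) => x /= <-.
  exact: (hP x).1.
by move=> i j _ _ [x [/= <-]].
Qed.

(** If g eventually bounded [bd E], almost all pieces of a partition above g would miss E_0, ...,
    E_n, leaving a finite union. *)
Lemma bounding_number_le_ideal_b (I : set (set nat)) : Fin `<=` I ->
  (bounding_number <= ideal_b I Fin Fin)%cardinal.
Proof.
move=> FI; apply: cardinal_min_le => k.
  by move=> [F [_ Fk]]; exact: has_card_le_continuum set_of_fun_inj Fk.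
move=> [EE [EEF EEu EEk]].
have [bd bdP] : {bd : (nat -> set nat) -> nat -> nat & forall E,
    (forall n, finite_set (E n)) ->
    forall n x, (\bigcup_(i < n.+1) E i) x -> (x < bd E n)%N}.
  apply: (@choice _ _ (fun E f => (forall n, finite_set (E n)) ->
    forall n x, (\bigcup_(i < n.+1) E i) x -> (x < f n)%N)) => E.
  have [finE|nfE] := pselect (forall n, finite_set (E n)).
    have [|f fP] := @finite_seq_bound (fun n => \bigcup_(i < n.+1) E i).
      by move=> n; apply: bigcup_finite => //; exact: finite_II.
    by exists f.
  by exists id.
have [l hl lk] := has_card_image bd set_of_fun_inj EEk.
exists l => //; exists (bd @` EE); split=> // g.
have [A PA Ag] := partition_above g.
have [E EEE nI] := EEu A PA; exists (bd E); first by exists E.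
move=> fin; apply: nI; apply: FI.
have [[finA _] _] := PA; have [finE _] := EEF E EEE.
(* Index 0 is included because the piece 0 need not lie above g(0). *)
pose N := [set 0%N] `|` [set n | (g n < bd E n)%N].
apply: (@sub_finite_set _ _ (\bigcup_(n in N) A n)).
  move=> x [n _ [Anx Ex]]; exists n => //.
  have [->|n0] := posnP n; [by left|right => /=].
  exact: leq_ltn_trans (Ag _ _ Anx n0) (bdP _ finE _ _ Ex).
apply: bigcup_finite => [|n _]; last exact: finA.
by rewrite finite_setU; split.
Qed.

(** This is the disjointification of the initial segments [0, g(n)). *)
Definition seq_of_fun (g : nat -> nat) (n : nat) : set nat :=
  [set x | (x < g n)%N /\ forall i, (i < n)%N -> (g i <= x)%N].

Lemma seq_of_fun_disjoint (g : nat -> nat) :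
  disjoint_seqs Fin (seq_of_fun g).
Proof.
split=> [n|i j _ _ [x [[xi ix] [xj jx]]]].
  by apply: (sub_finite_set _ (finite_II (g n))) => x [].
case: (ltngtP i j) => // [/jx|/ix]; first by rewrite leqNgt xi.
by rewrite leqNgt xj.
Qed.

Lemma seq_of_fun_cover (g : nat -> nat) (n x : nat) : (x < g n)%N ->
  (\bigcup_(i < n.+1) seq_of_fun g i) x.
Proof.
move=> xn; have ex : exists i, (x < g i)%N by exists n.
case: (ex_minnP ex) => i xi mini; exists i; first exact: mini.
by split=> // j; apply: contraTT; rewrite -ltnNge -leqNgt; exact: mini.
Qed.

(** Let f bound the pieces A_n and let g dominate f. Almost every A_n lies in [0, g(n)), hence in
    the first n + 1 terms of [seq_of_fun g], so the resulting union is cofinite. *)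
Lemma ideal_b_le_dominating_number (I : set (set nat)) : is_ideal I ->
  (ideal_b I Fin Fin <= dominating_number)%cardinal.
Proof.
move=> [IU Isub FI nIT]; apply: cardinal_min_le => k.
  by move=> [EE [_ _ EEk]]; exact: has_card_le_continuum set_of_seq_inj EEk.
move=> [D [domD Dk]].
have [l hl lk] := has_card_image seq_of_fun set_of_seq_inj Dk.
exists l => //; exists (seq_of_fun @` D); split=> //.
  by move=> _ [g _ <-]; exact: seq_of_fun_disjoint.
move=> A [[finA _] cA].
have [f fP] := finite_seq_bound finA.
have [g Dg fg] := domD f.
exists (seq_of_fun g); first by exists g.
move=> IE; apply: nIT.
have finC : finite_set (\bigcup_(n in [set n | (g n < f n)%N]) A n).
  by apply: bigcup_finite => // n _; exact: finA.
apply: (Isub _ _ _ (IU _ _ IE (FI _ finC))) => x _.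
have [n _ Anx] : (\bigcup_n A n) x by rewrite cA.
have [gf|fg'] := ltnP (g n) (f n); first by right; exists n.
left; exists n => //; split=> //; apply: seq_of_fun_cover.
exact: leq_trans (fP n x Anx) fg'.
Qed.

Theorem theorem4p5 (I : set (set nat)) (PI : is_P_ideal I) :
  [/\ (bounding_number <= ideal_b I Fin Fin)%cardinal,
      ideal_b I Fin Fin = ideal_b I I I,
      ideal_b I I I = ideal_b I Fin I,
      ideal_b I Fin I = ideal_b I I Fin
    & (ideal_b I I Fin <= dominating_number)%cardinal].
Proof.
have FI : Fin `<=` I by case: (PI) => -[_ _ + _] _.
have eqb J K := @ideal_b_P_ideal_eq I J K PI.
split.
- exact: bounding_number_le_ideal_b.
- by rewrite !eqb.
- by rewrite eqb.
- by rewrite [RHS]eqb.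
- rewrite eqb // -(eqb Fin Fin) //.
  by apply: ideal_b_le_dominating_number; case: PI.
Qed.
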